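(* Let $\mathbf{X}=[\mathbf{x}_1,\dots,\mathbf{x}_n]\in\mathbb{R}^{p\times n}$ be a deterministic data matrix, let $\mathbf{H}\mathbf{D}\in\mathbb{R}^{p\times p}$ be a fixed realization of the orthonormal preconditioning matrix, and let $\mathbf{Y}=\mathbf{H}\mathbf{D}\mathbf{X}=[\mathbf{y}_1,\dots,\mathbf{y}_n]$. Let $1\le m\le p$ and let $\mathbf{R}_1,\dots,\mathbf{R}_n\in\mathbb{R}^{p\times m}$ be independent random sampling matrices, where the $m$ columns of each $\mathbf{R}_i$ are chosen uniformly at random without replacement from the set of all $p$ canonical basis vectors of $\mathbb{R}^p$. Let $\mathcal{I}_k\subseteq\{1,\dots,n\}$ be the (fixed, nonempty) set of indices of the samples assigned to the $k$-th cluster, $n_k=|\mathcal{I}_k|$, and let $$\mathbf{H}_k=\frac pm\frac1{n_k}\sum_{i\in\mathcal{I}_k}\mathbf{R}_i\mathbf{R}_i^T,\qquad \mathbf{m}_k=\frac pm\frac1{n_k}\sum_{i\in\mathcal{I}_k}\mathbf{R}_i\mathbf{R}_i^T\mathbf{y}_i .$$ Let $\boldsymbol{\mu}_k'$ be given by the equation $\mathbf{H}_k\boldsymbol{\mu}_k'=\mathbf{m}_k$, and let $\boldsymbol{\mu}_k=(\mathbf{H}\mathbf{D})^T\boldsymbol{\mu}_k'$ be the $k$-th cluster center of the sparsified K-means update. Let $\overline{\mathbf{x}}_k=\frac1{n_k}\sum_{i\in\mathcal{I}_k}\mathbf{x}_i$ be the standard K-means update. Then for all $t\ge0$, $$\frac1{\sqrt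 p}\|\boldsymbol{\mu}_k-\overline{\mathbf{x}}_k\|_2\le t\left(1+\frac1{\sqrt p}\|\boldsymbol{\mu}_k\|_2\right)$$ with probability greater than $1-\max\{\delta_1,\delta_3\}$, where $$\delta_1=2p\exp\left(\frac{-n_kt^2/2}{\left(\frac pm-1\right)\|\mathbf{Y}\|_{\text{max-row}}^2/n_k+\tau(m,p)\|\mathbf{Y}\|_{\max}\,t/3}\right),\qquad \delta_3=p\exp\left(\frac{-n_kt^2/2}{\left(\frac pm-1\right)+\left(\frac pm+1\right)t/3}\right),$$ and $\tau(m,p)=\max\{\frac pm-1,\,1\}$.
   Context: The preconditioning matrix is $\mathbf{H}\mathbf{D}$, where $\mathbf{H}\in\mathbb{R}^{p\times p}$ is a deterministic orthonormal matrix (such as a normalized Hadamard or DCT matrix) and $\mathbf{D}$ is a diagonal matrix with diagonal entries in $\{\pm1\}$; thus $\mathbf{H}\mathbf{D}$ is orthonormal. ($\mathbf{H}_k$ is a different object from $\mathbf{H}$.) $\|\mathbf{Y}\|_{\max}$ is the maximum absolute value of the entries of $\mathbf{Y}$ and $\|\mathbf{Y}\|_{\text{max-row}}$ the maximum $\ell_2$ norm of its rows. Probability is over the sampling matrices. *)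

(* Defs.v *)
From HB Require Import structures.
From mathcomp Require Export all_boot all_order all_algebra.
From mathcomp Require Export all_classical all_reals all_analysis.
Export Order.TTheory GRing.Theory Num.Theory numFieldNormedType.Exports.

Set Implicit Arguments.
Unset Strict Implicit.
Unset Printing Implicit Defensive.

Local Open Scope classical_set_scope.
Local Open Scope ring_scope.

(* Borel measurable space of p x m matrices; [{mfun T >-> borel_mx R p m}] is
   the type of random matrices on T. *)
Definition borel_mx (R : realType) (p m : nat) :=
  g_sigma_algebraType (@open 'M[R]_(p, m)).

Definition mutually_independent d d' (T : measurableType d)
    (S : measurableType d') (R : realType) (P : probability T R)
    (I : finType) (X : I -> T -> S) : Prop :=
  forall (J : {set I}) (A : I -> set S), (forall i, measurable (A i)) ->
    (P (\bigcap_(i in [set` J]) (X i @^-1` A i)) =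
     \prod_(i in J) P (X i @^-1` A i))%E.

Section Vectors.
Context {R : realType}.

Definition l2norm (p : nat) (v : 'cV[R]_p) : R :=
  Num.sqrt (\sum_(j < p) v j 0 ^+ 2).

Definition maxrow_norm (p n : nat) (A : 'M[R]_(p, n)) : R :=
  \big[Num.max/0]_(j < p) l2norm (row j A)^T.

Definition orthonormal_mx (p : nat) (A : 'M[R]_p) : Prop := A^T *m A = 1%:M.

Definition sampling_mx (p m : nat) (f : 'I_m -> 'I_p) : 'M[R]_(p, m) :=
  \matrix_(j, l) (j == f l)%:R.

(* The columns are m ordered draws without replacement, so each of the
   p (p - 1) ... (p - m + 1) ordered m-tuples of distinct canonical basis
   vectors is equally likely. *)
Definition uniform_sampling d (T : measurableType d) (P : probability T R)
    (p m : nat) (X : T -> borel_mx R p m) : Prop :=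
  forall f : 'I_m -> 'I_p, injective f ->
    P (X @^-1` [set sampling_mx f]) = ((p ^_ m)%:R^-1)%:E.

End Vectors.

Section Sparsified.
Context {R : realType} (p m n : nat) (Ik : {set 'I_n}).
Context (S : 'I_n -> 'M[R]_(p, m)) (Y : 'M[R]_(p, n)).

Definition sampled_gram : 'M[R]_p :=
  (p%:R / m%:R / #|Ik|%:R) *: \sum_(i in Ik) S i *m (S i)^T.

Definition sampled_mean : 'cV[R]_p :=
  (p%:R / m%:R / #|Ik|%:R) *: \sum_(i in Ik) S i *m (S i)^T *m col i Y.

End Sparsified.

Section FailureProbabilities.
Context {R : realType}.

Definition tau (m p : nat) : R := Num.max (p%:R / m%:R - 1) 1.

(* [`|Y|] is the maximum absolute value of the entries of Y.
   The quotient is taken in the extended reals, where x / 0 = -oo for x < 0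
   and 0 / 0 = 0.  For t > 0 a vanishing denominator (Y = 0) therefore gives
   delta1 = 0, the limiting value of the formula, whereas division in R would
   give delta1 = 2p and make the resulting bound vacuous. *)
Definition delta1 (p m n : nat) (nk : nat) (Y : 'M[R]_(p, n)) (t : R) : \bar R :=
  ((2 * p)%:R%:E *
   expeR ((- (nk%:R * (t ^+ 2 / 2)))%:E /
     ((p%:R / m%:R - 1) * maxrow_norm Y ^+ 2 / nk%:R
       + tau m p * `|Y| * t / 3)%:E))%E.

Definition delta3 (p m : nat) (nk : nat) (t : R) : \bar R :=
  (p%:R%:E *
   expeR ((- (nk%:R * (t ^+ 2 / 2)))%:E /
     ((p%:R / m%:R - 1) + (p%:R / m%:R + 1) * t / 3)%:E))%E.

End FailureProbabilities.

(* Main.v *)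
(* H_k is diagonal, so a coordinate x of mu'_k is the mean of the sampled
   entries of the corresponding row a of Y (and is arbitrary when none is
   sampled).  If |x - abar| <= t (1 + |x|) in every coordinate, Minkowski's
   inequality gives the bound on mu'_k, hence on mu_k by orthogonality.

   Estimating m_k - ybar and H_k - 1 separately would give delta1 + delta3.  To
   get the maximum, each one-sided violation +-(x - abar) > t (1 + |x|) is
   turned into one linear event: the sum of the sampled b_i is nonnegative, where
   b = c a -+ (1 - c) with 0 < c <= 1 has mean -t, a convex combination of the
   two deviations.  With q = p/m, v the mean of b^2 and M a bound for (q - 2) b,
   the Chernoff bound is exp (- n_k t^2 / (2 F)), F = (q - 1) v + M t / 3.  If
   F1 and F3 are the denominators in delta1 and delta3, then F <= F1 or
   kappa F <= F3, with kappa = 4/3 + 2/(3(p - 1)).  In the first case the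
   factor 2 of delta1 pays for the two signs; in the second the larger exponent
   does, as 2 exp (- kappa z) <= exp (- z) once p exp (- z) <= 1, and otherwise
   delta3 > 1 and there is nothing to prove. *)

Require Import Defs.
From mathcomp Require Import ring lra.

Set Implicit Arguments.
Unset Strict Implicit.
Unset Printing Implicit Defensive.

Local Open Scope classical_set_scope.
Local Open Scope ring_scope.

(** * Moment generating function of a centred Bernoulli variable *)

Section BernoulliMgf.
Context {R : realType}.
Implicit Types f : R -> R.

Lemma ge0_of_derive_ge0 f (f' : R -> R) :
  (forall x, is_derive x (1 : R) f (f' x)) ->
  (forall x, 0 <= x -> 0 <= f' x) -> f 0 = 0 -> forall x, 0 <= x -> 0 <= f x.
Proof.
move=> df f'0 f0 x; rewrite le_eqVlt => /predU1P[<-|x0]; first by rewrite f0.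
have cf : {within `[0, x], continuous f}.
  apply: continuous_subspaceT => z; apply: differentiable_continuous.
  by apply/derivable1_diffP; apply: ex_derive.
have [c /[!in_itv]/=/andP[c0 _]] := MVT x0 (fun z _ => df z) cf.
by rewrite f0 !subr0 => ->; rewrite mulr_ge0 ?f'0// ltW.
Qed.

(** Both [h] and [h'] vanish at 0, and the derivative of [h'] is nonnegative because
    [expR (- w) >= 1 - w]. *)
Lemma expR_sub_quadratic (u : R) : 0 <= u < 3 ->
  expR u <= 1 + u + u ^+ 2 / (2 * (1 - u / 3)).
Proof.
move=> /andP[u0 u3].
pose h v : R := v ^+ 2 / 2 - (1 - v / 3) * (expR v - 1 - v).
pose h' v : R := v / 3 + 2 / 3 + expR v * (v - 2) / 3.
have h0 : 0 <= h u.
  apply: (@ge0_of_derive_ge0 h h') => //.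
  - move=> v; apply: is_derive_eq.
    by rewrite /GRing.scale /h' /=; lra.
  - move=> v v0.
    apply: (@ge0_of_derive_ge0 h' (fun w => (1 - expR w * (1 - w)) / 3)) => //.
    + move=> w; apply: is_derive_eq.
      by rewrite /GRing.scale /=; lra.
    + move=> w w0; rewrite divr_ge0// subr_ge0.
      rewrite -[leRHS](mulfV (lt0r_neq0 (expR_gt0 w))) ler_pM2l ?expR_gt0//.
      by rewrite -expRN; exact: expR_ge1Dx.
    + by rewrite /h' expR0; lra.
  - by rewrite /h expR0; lra.
have d0 : 0 < 1 - u / 3 by lra.
rewrite -lerBlDl ler_pdivlMr; last lra.
by rewrite /h in h0; lra.
Qed.


Lemma sinh_superlinear (a x : R) : 1 <= a -> 0 <= x ->
  a * (expR x - expR (- x)) <= expR (a * x) - expR (- (a * x)).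
Proof.
move=> a1 x0; rewrite -subr_ge0.
pose f z : R := expR (a * z) - expR (- (a * z)) - a * (expR z - expR (- z)).
pose f' z : R := a * (expR (a * z) + expR (- (a * z)) - expR z - expR (- z)).
apply: (@ge0_of_derive_ge0 f f') => // [z|z z0|].
- by apply: is_derive_eq; rewrite /GRing.scale /f' /=; ring.
- rewrite /f' mulr_ge0//; first lra.
  rewrite !expRN.
  set X := expR z; set Y := expR (a * z).
  have X1 : 1 <= X by rewrite /X -expR0 ler_expR.
  have XY : X <= Y by rewrite /X /Y ler_expR; nra.
  have -> : Y + Y^-1 - X - X^-1 = (Y - X) * (1 - (X * Y)^-1).
    by field; apply/andP; split; apply: lt0r_neq0; exact: expR_gt0.
  rewrite mulr_ge0 ?subr_ge0// invf_le1 ?mulr_gt0 ?expR_gt0//.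
  nra.
- by rewrite /f !mulr0 oppr0 expR0; lra.
Qed.

(** The lower tail is sub-Gaussian with the true variance [q - 1]. The ratio [w] of the two sides
    decreases: its derivative has the sign of [- g], and [g] is convex for [2 <= q] with
    [g 0 = g' 0 = 0]. *)
Lemma bernoulli_mgf_lower (q z : R) : 2 <= q -> 0 <= z ->
  1 - q^-1 + q^-1 * expR (- (q * z)) <= expR (- z + (q - 1) * z ^+ 2 / 2).
Proof.
move=> q2 z0.
pose w x : R := (1 - q^-1 + q^-1 * expR (- (q * x))) *
  expR (x - (q - 1) * x ^+ 2 / 2).
pose g x : R := expR (- (q * x)) * (1 + x) - 1 + (q - 1) * x.
pose g' x : R := expR (- (q * x)) * (1 - q - q * x) + (q - 1).
have g0 x : 0 <= x -> 0 <= g x.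
  apply: (@ge0_of_derive_ge0 g g') => // [v|v|].
  - by apply: is_derive_eq; rewrite /GRing.scale /g' /=; ring.
  - apply: (@ge0_of_derive_ge0 g'
      (fun v => expR (- (q * v)) * (q * (q - 2 + q * v)))) => // [u|u u0|].
    + by apply: is_derive_eq; rewrite /GRing.scale /=; ring.
    + by rewrite mulr_ge0 ?expR_ge0//; nra.
    + by rewrite /g' !mulr0 oppr0 expR0; lra.
  - by rewrite /g !mulr0 oppr0 expR0; lra.
have : 0 <= 1 - w z.
  apply: (@ge0_of_derive_ge0 (fun x => 1 - w x)
    (fun x => expR (x - (q - 1) * x ^+ 2 / 2) * ((q - 1) / q * g x))) => //.
  - move=> v; apply: is_derive_eq; rewrite /GRing.scale /g /=.
    by field; lra.
  - move=> v v0; rewrite mulr_ge0 ?expR_ge0// mulr_ge0 ?g0//.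
    by rewrite divr_ge0; lra.
  - by rewrite /w !mulr0 oppr0 expr0n/= mulr0 mul0r subr0 expR0; field; lra.
rewrite subr_ge0 /w -ler_pdivlMr ?expR_gt0// -expRN mul1r => /le_trans; apply.
by rewrite ler_expR; lra.
Qed.

(** A Bennett bound whose rate is [k = q - 2] instead of the range [q - 1]. Up to a positive factor
    the derivative [r] is the difference of the two sides of [sinh_superlinear] at [a = q - 1];
    [expR_sub_quadratic] then bounds [B]. *)
Lemma bernoulli_mgf_upper (q x : R) : 2 < q -> 0 <= x -> (q - 2) * x < 3 ->
  1 - q^-1 + q^-1 * expR (q * x) <=
  expR (x + (q - 1) * x ^+ 2 / (2 * (1 - (q - 2) * x / 3))).
Proof.
move=> q2 x0 qx3; set k := q - 2.
pose B v : R := (expR (k * v) - 1 - k * v) / k ^+ 2.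
pose w v : R := (1 - q^-1 + q^-1 * expR (q * v)) *
  expR (- v - (q - 1) * B v).
pose r v : R := expR (- v - (q - 1) * B v) * ((q - 1) / q / k *
  ((q - 1 + expR (q * v)) * (expR (k * v) - 1) - k * (expR (q * v) - 1))).
have : 0 <= 1 - w x.
  apply: (@ge0_of_derive_ge0 (fun v => 1 - w v) r) => //.
  - move=> v; apply: is_derive_eq; rewrite /GRing.scale /r /B /=.
    by rewrite /k; field; apply/andP; split; lra.
  - move=> v v0; rewrite mulr_ge0 ?expR_ge0// mulr_ge0//.
      by rewrite !divr_ge0// /k; lra.
    have -> : k * v = (q - 1) * v + - v by rewrite /k; ring.
    have -> : q * v = (q - 1) * v + v by ring.
    have q1 : 1 <= q - 1 by lra.
    have := sinh_superlinear q1 v0; rewrite !expRD !expRN.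
    set E := expR ((q - 1) * v); set X := expR v => EX.
    have E0 : 0 < E by exact: expR_gt0.
    have X0 : 0 < X by exact: expR_gt0.
    rewrite -subr_ge0 in EX; move: (mulr_ge0 (ltW E0) EX).
    congr (_ <= _); rewrite /k; field; apply/andP; split; exact: lt0r_neq0.
  - rewrite /w /B !mulr0 expR0 subrr subr0 mul0r mulr0 subr0 oppr0 expR0.
    by field; lra.
rewrite subr_ge0 /w -ler_pdivlMr ?expR_gt0// -expRN mul1r => /le_trans; apply.
rewrite ler_expR opprB opprK addrC lerD2l -mulrA ler_wpM2l; [by []|lra|].
rewrite /B ler_pdivrMr; last by rewrite exprn_gt0// /k; lra.
have kx : 0 <= k * x < 3 by rewrite mulr_ge0//= /k; lra.
have := expR_sub_quadratic kx; rewrite exprMn => H.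
have -> : x ^+ 2 / (2 * (1 - k * x / 3)) * k ^+ 2 =
  k ^+ 2 * x ^+ 2 / (2 * (1 - k * x / 3)) by ring.
lra.
Qed.

(* q d - 1, for d Bernoulli of parameter 1/q, has third cumulant
   (q - 1) (q - 2), so the Bernstein correction is only needed on one side. *)
Lemma bernoulli_mgf (q x W : R) : 1 < q -> (q - 2) * x <= W -> 0 <= W < 3 ->
  1 - q^-1 + q^-1 * expR (q * x) <=
  expR (x + (q - 1) * x ^+ 2 / (2 * (1 - W / 3))).
Proof.
have mono (a v V : R) : 0 <= a -> v <= V -> V < 3 ->
    a / (2 * (1 - v / 3)) <= a / (2 * (1 - V / 3)).
  move=> a0 vV V3; rewrite ler_wpM2l// lef_pV2 ?posrE; lra.
have main (p y V : R) : 2 <= p -> (p - 2) * y <= V -> 0 <= V < 3 ->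
    1 - p^-1 + p^-1 * expR (p * y) <=
    expR (y + (p - 1) * y ^+ 2 / (2 * (1 - V / 3))).
  move=> p2 pyV /andP[V0 V3].
  have a0 : 0 <= (p - 1) * y ^+ 2 by rewrite mulr_ge0 ?sqr_ge0//; lra.
  have [y0|y0] := leP y 0.
    have y0' : 0 <= - y by lra.
    have := bernoulli_mgf_lower p2 y0'; rewrite mulrN !opprK sqrrN.
    move/le_trans; apply; rewrite ler_expR lerD2l.
    by have := mono _ 0 V a0 V0 V3; rewrite mul0r subr0 mulr1.
  (* At [p = 2] the centred variable is a symmetric sign, so the lower-tail bound serves for [y > 0]
     too. *)
  move: p2; rewrite le_eqVlt => /predU1P[p2|p2].
    have le22 : (2 : R) <= 2 by [].
    have := bernoulli_mgf_lower le22 (ltW y0).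
    rewrite -p2 -(ler_pM2l (expR_gt0 (2 * y))) -expRD => H.
    have -> : 1 - 2^-1 + 2^-1 * expR (2 * y) =
      expR (2 * y) * (1 - 2^-1 + 2^-1 * expR (- (2 * y))).
      by rewrite expRN; field; exact: lt0r_neq0 (expR_gt0 _).
    apply: (le_trans H); rewrite ler_expR.
    have := mono _ 0 V a0 V0 V3; rewrite mul0r subr0 mulr1 -p2; lra.
  apply: (le_trans (bernoulli_mgf_upper p2 (ltW y0) _)); first lra.
  rewrite ler_expR lerD2l; exact: mono.
move=> q1 qxW W03; have [q2|q2] := leP 2 q; first exact: main.
(* Conjugate exponent: [1 - d] is Bernoulli of parameter [p^-1], and [q * d - 1 = - (q - 1) * (p *
   (1 - d) - 1)]. This exchanges [q < 2] for [2 <= p]. *)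
pose p := q / (q - 1).
have p2 : 2 <= p by rewrite /p ler_pdivlMr; lra.
have q10 : q - 1 != 0 by lra.
have q0 : q != 0 by lra.
have := main p (- ((q - 1) * x)) W p2.
have -> : (p - 2) * - ((q - 1) * x) = (q - 2) * x by rewrite /p; field.
move=> /(_ qxW W03); rewrite -(ler_pM2l (expR_gt0 (q * x))) -expRD.
congr (_ <= _).
  have -> : p * - ((q - 1) * x) = - (q * x) by rewrite /p; field.
  by rewrite expRN /p; field; rewrite q10 q0 /= lt0r_neq0// expR_gt0.
have W3 : 2 * (1 - W / 3) != 0 by case/andP: W03 => W0 W3; lra.
congr (expR _); rewrite sqrrN.
have -> : (p - 1) * ((q - 1) * x) ^+ 2 = (q - 1) * x ^+ 2 by rewrite /p; field.
ring.
Qed.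

End BernoulliMgf.

(** * Comparison of the Bernstein denominators *)

(* [y] and [s] are the mean and the variance of a row [a], [c] is the weight of
   the tilt [b = c a -+ (1 - c)], whose second moment is [c ^+ 2 * s + t ^+ 2],
   and [A] bounds [`|a|].  For [q < 2] we put [g = q - 1]; for [2 <= q] everything
   is divided by [q - 1] and [w = 2 / (3 * (q - 1))], except in [tradeoff_far]. *)
Section Tradeoff.
Context {R : realType}.
Implicit Types t y s A c w g G : R.

(** For [c < 1] the last bracket has the sign of the change in second moment caused by the tilt; the
    case distinctions below are made on it. *)
Lemma tilted_moment_diff t y s c : c * (1 + y) = 1 - t ->
  c ^+ 2 * s + t ^+ 2 =
  s + y ^+ 2 + (1 - c) * ((1 + y) * (t - y) - (1 + c) * s).
Proof.
move=> cE; have -> : t = 1 - c * (1 + y) by rewrite cE; ring.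
by ring.
Qed.

Lemma tilted_moment_le t y s c : 0 < t < 1 -> - t <= y -> 0 < c <= 1 ->
  c * (1 + y) = 1 - t -> (1 + c) * s <= (1 + y) * (t - y) ->
  c ^+ 2 * s + t ^+ 2 <= t.
Proof.
move=> /andP[t0 t1] ty /andP[c0 c1] cE X0.
have cy : - (c * y) <= t by nra.
suff : (1 + c) * (c ^+ 2 * s) <= (1 + c) * (t * (1 - t)).
  by rewrite ler_pM2l; [lra|lra].
have -> : (1 + c) * (c ^+ 2 * s) = c ^+ 2 * ((1 + c) * s) by ring.
have c20 : 0 <= c ^+ 2 by exact: sqr_ge0.
apply: (le_trans (ler_wpM2l c20 X0)).
have -> : c ^+ 2 * ((1 + y) * (t - y)) = (1 - t) * (c * (t - y)).
  by rewrite -cE; ring.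
have -> : (1 + c) * (t * (1 - t)) = (1 - t) * (t + c * t) by ring.
by apply: ler_wpM2l; [lra|lra].
Qed.

(** Adding [c] times the bracket leaves [t ^+ 2 + (1 - t) * (t - y) - c * s], and [- y <= t]. *)
Lemma tilted_moment_add t y s c : 0 < t < 1 -> - t <= y -> 0 < c <= 1 ->
  0 <= s -> c * (1 + y) = 1 - t ->
  c ^+ 2 * s + t ^+ 2 + c * ((1 + y) * (t - y) - (1 + c) * s) <=
  2 * t - t ^+ 2.
Proof.
move=> /andP[t0 t1] ty /andP[c0 c1] s0 cE.
have -> : c ^+ 2 * s + t ^+ 2 + c * ((1 + y) * (t - y) - (1 + c) * s) =
  t ^+ 2 + (c * (1 + y)) * (t - y) - c * s by ring.
rewrite cE; have : 0 <= c * s by rewrite mulr_ge0// ltW.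
nra.
Qed.

(** If the bracket [X] is small, the gain in second moment is paid for by the smaller range and the
    first bound on [G] suffices. If [X] is large, the variance is so small that a bound in [t] alone
    remains, which the second bound on [G] covers. *)
Lemma tradeoff_rare t y s A c w G : 0 < t < 1 -> - t <= y -> 0 < c <= 1 ->
  0 <= s -> 0 <= A -> 0 < w <= 2 / 3 -> c * (1 + y) = 1 - t ->
  s + y ^+ 2 + A * t / 3 <= G -> 1 + t / 3 + w * t <= (4 / 3 + w) * G ->
  c ^+ 2 * s + t ^+ 2 + t / 3 * Num.max (c * A - (1 - c)) 0 <= G.
Proof.
move=> t01 ty c01 s0 A0 /andP[w0 w1] cE G1 G3.
have /andP[t0 t1] := t01; have /andP[c0 c1] := c01.
have w43 : 0 < 4 / 3 + w by lra.
have At0 : 0 <= A * t / 3 by rewrite divr_ge0// mulr_ge0// ltW.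
have D := tilted_moment_diff s cE.
set X := (1 + y) * (t - y) - (1 + c) * s in D.
have [m0|m0] := leP (c * A - (1 - c)) 0.
  rewrite mulr0 addr0; have [X0|X0] := leP X 0.
    by rewrite D; have := mulr_ge0_le0 (_ : 0 <= 1 - c) X0; lra.
  apply: le_trans (_ : t <= _).
    by apply: (@tilted_moment_le t y s c) => //; rewrite /X in X0; lra.
  rewrite -(ler_pM2l w43); nra.
have [XA|XA] := leP X (t / 3 * (1 + A)).
  apply: le_trans G1; rewrite D.
  have : (1 - c) * X <= (1 - c) * (t / 3 * (1 + A)) by rewrite ler_wpM2l; lra.
  lra.
have H := tilted_moment_add t01 ty c01 s0 cE; rewrite -/X in H.
have cX : c * (t / 3 * (1 + A)) <= c * X by rewrite ler_wpM2l ?ltW.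
apply: le_trans (_ : 5 * t / 3 - t ^+ 2 <= _); first lra.
rewrite -(ler_pM2l w43); apply: le_trans G3.
(* The claim is affine in [w], hence interpolated between [w = 0] and [w = 2 / 3]. The two
   quadratics in [t] are positive, with vertices [17 / 24] and [7 / 12]. *)
suff : 0 <= (1 - 3 / 2 * w) * (1 + t / 3 - 4 / 3 * (5 * t / 3 - t ^+ 2)) +
  3 / 2 * w * (1 + t - 2 * (5 * t / 3 - t ^+ 2)) by lra.
have := sqr_ge0 (t - 17 / 24); have := sqr_ge0 (t - 7 / 12) => s1 s2.
by rewrite addr_ge0// mulr_ge0; lra.
Qed.

(** The same dichotomy. As [q - 2 = - (1 - g)] is negative, the range term comes from the most
    negative value of the tilt, so [A - 1] replaces [A + 1] in the threshold. *)
Lemma tradeoff_frequent t y s A c g G : 0 < t < 1 -> - t <= y -> 0 < c <= 1 ->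
  0 <= s -> 0 <= A -> 0 < g < 1 -> c * (1 + y) = 1 - t ->
  g * (s + y ^+ 2) + A * t / 3 <= G -> g + (g + 2) * t / 3 <= 5 / 3 * G ->
  g * (c ^+ 2 * s + t ^+ 2) + t / 3 * ((1 - g) * (c * A + (1 - c))) <= G.
Proof.
move=> t01 ty c01 s0 A0 /andP[g0 g1] cE G1 G3.
have /andP[t0 t1] := t01; have /andP[c0 c1] := c01.
have D := tilted_moment_diff s cE.
set X := (1 + y) * (t - y) - (1 + c) * s in D.
have [XA|XA] := leP (g * X) (t / 3 * (1 - g) * (A - 1)).
  apply: le_trans G1; rewrite D.
  have : (1 - c) * (g * X) <= (1 - c) * (t / 3 * (1 - g) * (A - 1)).
    by rewrite ler_wpM2l; lra.
  have : 0 <= t / 3 * A * g by rewrite !mulr_ge0//; lra.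
  lra.
have H := tilted_moment_add t01 ty c01 s0 cE; rewrite -/X in H.
have cX : c * (t / 3 * (1 - g) * (A - 1)) <= c * (g * X).
  by rewrite ler_wpM2l ?ltW.
have gH := ler_wpM2l (ltW g0) H.
apply: le_trans (_ : g * (2 * t - t ^+ 2) + (1 - g) * (t / 3) <= _); first lra.
have : 0 <= g * (1 + t / 3 - 5 / 3 * (5 * t / 3 - t ^+ 2)).
  have sq := sqr_ge0 (t - 11 / 15).
  by rewrite mulr_ge0//; lra.
lra.
Qed.

(** The first denominator alone suffices: the second moment drops by at least [(- y - t) * (t / 3)],
    which pays for the shift [1 - c <= - y - t] of the range. *)
Lemma tradeoff_far t y s A c q G : 0 < t -> y < - t -> 0 < c <= 1 ->
  0 <= s -> 0 <= A -> 2 <= q -> c * (1 - y) = 1 + t ->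
  (q - 1) * (s + y ^+ 2) + (q - 1) * A * t / 3 <= G ->
  (q - 1) * (c ^+ 2 * s + t ^+ 2) + t / 3 * ((q - 2) * (c * A + (1 - c))) <= G.
Proof.
move=> t0 yt /andP[c0 c1] s0 A0 q2 cE G1; apply: le_trans G1.
have c2s : c ^+ 2 * s <= s by rewrite ler_piMl//; nra.
have d0 : 0 <= - y - t by lra.
have cd : 1 - c <= - y - t by nra.
have cA : c * A <= A by rewrite ler_piMl.
have v : c ^+ 2 * s + t ^+ 2 + (- y - t) * (t / 3) <= s + y ^+ 2 by nra.
have e0 : 0 <= q - 1 by lra.
have H1 := ler_wpM2l e0 v.
have : (q - 2) * (c * A + (1 - c)) <= (q - 1) * (A + (- y - t)).
  apply: le_trans (_ : (q - 2) * (A + (- y - t)) <= _).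
    by apply: ler_wpM2l; lra.
  by apply: ler_wpM2r; lra.
rewrite -(ler_pM2l (_ : 0 < t / 3)); last lra.
lra.
Qed.

End Tradeoff.

(** * Chernoff bounds over sampling patterns *)

Section Patterns.
Context {R : realType} {I : finType}.
Implicit Types (f : {ffun I -> bool}) (a b z : I -> R) (r q t : R).

Definition pattern_weight r f : R := \prod_i (if f i then r else 1 - r).

(** The exponential is at least 1 on bad patterns, and its expectation factors over the indices.
    Strictness comes from [f0], which has positive weight and counts on the right only. *)
Lemma chernoff_lt r z (bad : pred {ffun I -> bool}) f0 : 0 < r < 1 ->
  (forall f, bad f -> 0 <= \sum_(i | f i) z i) -> ~~ bad f0 ->
  \sum_(f | bad f) pattern_weight r f < \prod_i (1 - r + r * expR (z i)).
Proof.
move=> /andP[r0 r1] badz nbad.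
pose F i (b : bool) := if b then r * expR (z i) else 1 - r.
have -> : \prod_i (1 - r + r * expR (z i)) =
    \sum_f pattern_weight r f * expR (\sum_(i | f i) z i).
  transitivity (\prod_i \sum_b F i b).
    by apply: eq_bigr => i _; rewrite big_bool /F addrC.
  rewrite bigA_distr_bigA/=; apply: eq_bigr => f _.
  rewrite expR_sum [\prod_(i | f i) _]big_mkcond -big_split/=.
  by apply: eq_bigr => i _; rewrite /F; case: ifP => // _; rewrite mulr1.
have W0 f : 0 < pattern_weight r f.
  by apply: prodr_gt0 => i _; case: ifP => _ //; rewrite subr_gt0.
rewrite big_mkcond (bigD1 f0)//= [ltRHS](bigD1 f0)//= (negbTE nbad).
apply: ltr_leD; first by rewrite mulr_gt0 ?expR_gt0.
apply: ler_sum => f _; case: ifP => [bf|_].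
  by rewrite ler_peMr ?(ltW (W0 f))// -expR0 ler_expR badz.
by rewrite mulr_ge0 ?(ltW (W0 f)) ?expR_ge0.
Qed.

(** Apply [bernoulli_mgf] with [x = t / G * b i] and [W = t / G * M]. The linear terms sum to
    [- #|K| * t ^+ 2 / G], and the condition on [G] keeps the quadratic ones below half of that. *)
Lemma bernstein_prod (K : {set I}) b q t v M G : 1 < q -> 0 < t -> 0 < v ->
  0 <= M -> \sum_(i in K) b i = - (#|K|%:R * t) ->
  \sum_(i in K) b i ^+ 2 = #|K|%:R * v ->
  (forall i, i \in K -> (q - 2) * b i <= M) -> (q - 1) * v + t / 3 * M <= G ->
  \prod_i (1 - q^-1 + q^-1 * expR (if i \in K then q * (t / G * b i) else 0))
  <= expR (- (#|K|%:R * (t ^+ 2 / 2)) / G).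
Proof.
move=> q1 t0 v0 M0 sumb sumb2 bM HG.
have tM0 : 0 <= t / 3 * M by rewrite mulr_ge0//; lra.
have qv0 : 0 < (q - 1) * v by rewrite mulr_gt0//; lra.
have G0 : 0 < G by lra.
have l0 : 0 < t / G by rewrite divr_gt0.
have W3 : t / G * M < 3.
  by rewrite mulrAC ltr_pdivrMr//; lra.
have W0 : 0 <= t / G * M by rewrite mulr_ge0// ltW.
pose D := 2 * (1 - t / G * M / 3).
have D0 : 0 < D by rewrite /D; lra.
apply: le_trans (_ : expR (\sum_(i in K) (t / G * b i +
    (q - 1) * (t / G * b i) ^+ 2 / D)) <= _).
  rewrite [X in expR X]big_mkcond expR_sum.
  apply: ler_prod => i _; apply/andP; split.
    rewrite addr_ge0 ?mulr_ge0 ?expR_ge0 ?invr_ge0//; last by lra.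
    by rewrite subr_ge0 invf_le1; lra.
  case: ifPn => iK; last by rewrite !expR0; lra.
  apply: bernoulli_mgf => //; last by rewrite W0.
  by rewrite mulrCA ler_pM2l// bM.
rewrite ler_expR big_split/= -mulr_sumr sumb.
have -> : \sum_(i in K) (q - 1) * (t / G * b i) ^+ 2 / D =
    (q - 1) * (t / G) ^+ 2 / D * (#|K|%:R * v).
  by rewrite -sumb2 mulr_sumr; apply: eq_bigr => i _; ring.
have N0 : (0 : R) <= #|K|%:R by [].
suff : (q - 1) * (t / G) ^+ 2 / D * v <= t / G * t / 2.
  by move/(ler_wpM2l N0); lra.
have -> : (q - 1) * (t / G) ^+ 2 / D * v = (t / G) ^+ 2 * ((q - 1) * v) / D.
  by ring.
rewrite ler_pdivrMr//.
have -> : t / G * t / 2 * D = (t / G) ^+ 2 * (G - t / 3 * M).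
  by rewrite /D; field; exact: lt0r_neq0.
by rewrite ler_pM2l ?exprn_gt0//; lra.
Qed.

(* [x] plays the role of an entry of mu'; when no index is sampled, the first
   condition is void and [x] is arbitrary. *)
Definition overshoot (K : {set I}) a t f : Prop :=
  exists x, \sum_(i in K | f i) (x - a i) = 0 /\
    t * (1 + `|x|) < x - #|K|%:R^-1 * \sum_(i in K) a i.

(** [G] dominates the first denominator and [kappa^-1] times the second simultaneously, so a single
    exponent is obtained whichever of them is decisive. *)
Lemma overshoot_lt (K : {set I}) a q t A kappa G : K != finset.set0 ->
  1 < q -> 0 < t -> (forall i, i \in K -> `|a i| <= A) -> 0 < kappa ->
  (2 <= q -> kappa <= 4 / 3 + 2 / (3 * (q - 1))) -> (q < 2 -> kappa <= 5 / 3) ->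
  (q - 1) * (#|K|%:R^-1 * \sum_(i in K) a i ^+ 2) +
    Num.max (q - 1) 1 * A * t / 3 <= G ->
  (q - 1) + (q + 1) * t / 3 <= kappa * G ->
  \sum_(f | `[< overshoot K a t f >]) pattern_weight q^-1 f <
  expR (- (#|K|%:R * (t ^+ 2 / 2)) / G).
Proof.
move=> K0 q1 t0 aA k0 kq2 kq1 G1 G3.
have N0 : (0 : R) < #|K|%:R by rewrite ltr0n card_gt0.
have NN := lt0r_neq0 N0.
set N : R := #|K|%:R in N0 NN *.
pose y : R := N^-1 * \sum_(i in K) a i.
pose s : R := N^-1 * \sum_(i in K) a i ^+ 2 - y ^+ 2.
have suma : \sum_(i in K) a i = N * y by rewrite /y mulVKf.
have suma2 : \sum_(i in K) a i ^+ 2 = N * (s + y ^+ 2).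
  by rewrite /s subrK mulVKf.
have s0 : 0 <= s.
  have : 0 <= \sum_(i in K) (a i - y) ^+ 2.
    by apply: sumr_ge0 => i _; exact: sqr_ge0.
  have -> : \sum_(i in K) (a i - y) ^+ 2 = N * s.
    transitivity (\sum_(i in K) (a i ^+ 2 + (- (2 * y) * a i + y ^+ 2))).
      by apply: eq_bigr => i _; ring.
    rewrite !big_split/= suma2 -mulr_sumr suma sumr_const -mulr_natl -/N.
    by ring.
  by rewrite pmulr_rge0.
have A0 : 0 <= A.
  by have /finset.set0Pn[i iK] := K0; exact: le_trans (normr_ge0 _) (aA _ iK).
rewrite -/y in G1.
have {}G1 : (q - 1) * (s + y ^+ 2) + Num.max (q - 1) 1 * A * t / 3 <= G.
  by move: G1; rewrite suma2 mulKf.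
have aS i : i \in K -> - A <= a i <= A by move=> /aA; rewrite ler_norml.
have e0 : 0 < q - 1 by lra.
have G0 : 0 <= G.
  have max0 : 0 <= Num.max (q - 1) 1 by rewrite le_max ler01 orbT.
  apply: le_trans G1; apply: addr_ge0; last by rewrite divr_ge0 ?mulr_ge0// ltW.
  by rewrite mulr_ge0 ?(ltW e0)// addr_ge0 ?sqr_ge0.
have key (c d M : R) : 0 < c -> 0 <= M -> c * y + d = - t ->
    (forall f, overshoot K a t f -> 0 <= \sum_(i in K | f i) (c * a i + d)) ->
    (forall i, i \in K -> (q - 2) * (c * a i + d) <= M) ->
    (q - 1) * (c ^+ 2 * s + t ^+ 2) + t / 3 * M <= G ->
    \sum_(f | `[< overshoot K a t f >]) pattern_weight q^-1 f <
    expR (- (N * (t ^+ 2 / 2)) / G).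
  move=> c0 M0 cy pos bM HG.
  have sb : \sum_(i in K) (c * a i + d) = - (N * t).
    rewrite big_split/= -mulr_sumr suma sumr_const -mulr_natl -/N -mulrN -cy.
    by ring.
  have sb2 : \sum_(i in K) (c * a i + d) ^+ 2 = N * (c ^+ 2 * s + t ^+ 2).
    transitivity (\sum_(i in K)
      (c ^+ 2 * a i ^+ 2 + (2 * c * d * a i + d ^+ 2))).
      by apply: eq_bigr => i _; ring.
    rewrite !big_split/= -!mulr_sumr suma suma2 sumr_const -mulr_natl -/N.
    by rewrite -[t ^+ 2]sqrrN -cy; ring.
  have v0 : 0 < c ^+ 2 * s + t ^+ 2.
    by rewrite ltr_wpDl ?exprn_gt0// mulr_ge0 ?sqr_ge0.
  apply: lt_le_trans (bernstein_prod q1 t0 v0 M0 sb sb2 bM HG).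
  (* When everything is sampled, [x] equals the mean [y] and cannot overshoot. *)
  apply: (@chernoff_lt _ _ _ [ffun=> true]).
  - by rewrite invr_gt0 invf_lt1//; lra.
  - move=> f /asboolP /pos.
    have -> : \sum_(i | f i)
          (if i \in K then q * (t / G * (c * a i + d)) else 0) =
        q * (t / G) * \sum_(i in K | f i) (c * a i + d).
      rewrite mulr_sumr [LHS]big_mkcond [RHS]big_mkcond/=.
      apply: eq_bigr => i _.
      by case: (f i); case: (i \in K); rewrite /= ?mulrA.
    apply: mulr_ge0 => //; rewrite mulr_ge0 ?divr_ge0//; lra.
  - apply/asboolPn => -[x [+ xy]].
    have -> : \sum_(i in K | [ffun=> true] i) (x - a i) = N * (x - y).
      under eq_bigl do rewrite ffunE andbT.
      by rewrite sumrB sumr_const suma -mulr_natl -/N; ring.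
    move=> /eqP; rewrite mulf_eq0 (negbTE NN)/= => /eqP xy0.
    move: xy; rewrite -/y xy0; apply/negP; rewrite -leNgt.
    by rewrite mulr_ge0 ?ltW// addr_ge0.
(* Since [x] is the mean of the sampled entries, the sampled sum of an affine tilt has the sign of
   its value at [x]. *)
have lin (f : {ffun I -> bool}) (c d x : R) :
    \sum_(i in K | f i) (x - a i) = 0 ->
    0 <= c * x + d -> 0 <= \sum_(i in K | f i) (c * a i + d).
  move=> sx cx; have -> : \sum_(i in K | f i) (c * a i + d) =
      \sum_(i in K | f i) (c * x + d) - c * \sum_(i in K | f i) (x - a i).
    by rewrite mulr_sumr -sumrB; apply: eq_bigr => i _; ring.
  by rewrite sx mulr0 subr0; apply: sumr_ge0.
clear suma suma2 NN.
have [yt|yt] := ltP y (- t).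
  clear G3 kq1 kq2 k0.
  (* The tilt [c * a + (1 - c)] has mean [- t] and vanishes at the overshoot threshold
     [(y + t) / (1 + t)], which is negative here. *)
  pose c := (1 + t) / (1 - y).
  have cE : c * (1 - y) = 1 + t by rewrite /c divfK//; lra.
  have c01 : 0 < c <= 1 by rewrite /c divr_gt0 ?ler_pdivrMr//; lra.
  have /andP[c0 c1] := c01.
  have cA : 0 <= c * A by rewrite mulr_ge0// ltW.
  have cAa i : i \in K -> - (c * A) <= c * a i <= c * A.
    by move=> /aS /andP[? ?]; rewrite -mulrN !ler_pM2l//; apply/andP.
  have pos f : overshoot K a t f ->
      0 <= \sum_(i in K | f i) (c * a i + (1 - c)).
    move=> [x [sx xy]]; apply: (lin _ _ _ _ sx); rewrite -/y in xy.
    have y1 : 0 < 1 - y by lra.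
    rewrite -(pmulr_lge0 _ y1) mulrDl mulrAC cE mulrBl cE mul1r.
    have [x0|x0] := leP 0 x; first nra.
    by rewrite ltr0_norm// in xy; lra.
  have [q2|q2] := leP 2 q.
    apply: (key c (1 - c) ((q - 2) * (c * A + (1 - c)))) => //.
    - by rewrite mulr_ge0//; lra.
    - by lra.
    - by move=> i /cAa /andP[? ?]; apply: ler_wpM2l; lra.
    - apply: (@tradeoff_far _ _ y) => //.
      by move: G1; rewrite max_l//; lra.
  apply: (key c (1 - c) ((2 - q) * (c * A))) => //.
  - by rewrite mulr_ge0//; lra.
  - by lra.
  - move=> i /cAa /andP[? ?].
    have -> : (q - 2) * (c * a i + (1 - c)) =
      (2 - q) * (- (c * a i) - (1 - c)) by ring.
    by apply: ler_wpM2l; lra.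
  - apply: le_trans G1; rewrite max_r; last lra.
    have c2s : c ^+ 2 * s <= s by rewrite ler_piMl//; nra.
    have cAA : (2 - q) * (c * A) <= A.
      apply: le_trans (_ : c * A <= _); last exact: ler_piMl.
      by apply: ler_piMl; lra.
    have v : c ^+ 2 * s + t ^+ 2 <= s + y ^+ 2 by nra.
    have vq := ler_wpM2l (ltW e0) v.
    have t30 : 0 <= t / 3 by lra.
    by have := ler_wpM2l t30 cAA; lra.
(* For [1 <= t] and [- t <= y], [t * (1 + |x|) >= t + |x| >= x - y], so no pattern overshoots. *)
have [t1|t1] := leP 1 t.
  rewrite big_pred0 ?expR_gt0// => f; apply/asboolPn => -[x [_]]; rewrite -/y.
  by have := ler_norm x; have := normr_ge0 x; nra.
have y1 : 0 < 1 + y by lra.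
(* Now the threshold [(y + t) / (1 - t)] is nonnegative; the tilt [c * a - (1 - c)] vanishes there
   and has mean [- t]. *)
pose c := (1 - t) / (1 + y).
have cE : c * (1 + y) = 1 - t by rewrite /c divfK//; lra.
have c01 : 0 < c <= 1 by rewrite /c divr_gt0 ?ler_pdivrMr//; lra.
have /andP[c0 c1] := c01.
have t01 : 0 < t < 1 by rewrite t0.
have cA : 0 <= c * A by rewrite mulr_ge0// ltW.
have cAa i : i \in K -> - (c * A) <= c * a i <= c * A.
  by move=> /aS /andP[? ?]; rewrite -mulrN !ler_pM2l//; apply/andP.
have pos f : overshoot K a t f ->
    0 <= \sum_(i in K | f i) (c * a i + - (1 - c)).
  move=> [x [sx xy]]; apply: (lin _ _ _ _ sx); rewrite -/y in xy.
  rewrite -(pmulr_lge0 _ y1).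
  have -> : (c * x + - (1 - c)) * (1 + y) =
    c * (1 + y) * x - (1 + y) + c * (1 + y) by ring.
  rewrite cE.
  have [x0|x0] := leP 0 x; first by rewrite ger0_norm// in xy; lra.
  by rewrite ltr0_norm// in xy; nra.
have [q2|q2] := leP 2 q.
  (* Enlarging the factor [q - 2] to [q - 1] lets the whole inequality be divided by [q - 1]. *)
  apply: (key c (- (1 - c)) ((q - 1) * Num.max (c * A - (1 - c)) 0)) => //.
  - by rewrite mulr_ge0 ?le_max ?lexx ?orbT// ltW.
  - by lra.
  - move=> i /cAa /andP[? ?].
    apply: le_trans (_ : (q - 2) * Num.max (c * A - (1 - c)) 0 <= _).
      by apply: ler_wpM2l; [lra|rewrite le_max; apply/orP; left; lra].
    by apply: ler_wpM2r; [rewrite le_max lexx orbT|lra].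
  - pose w := 2 / (3 * (q - 1)).
    have -> : G = (q - 1) * (G / (q - 1)) by field; exact: lt0r_neq0.
    rewrite mulrCA -mulrDr ler_pM2l//.
    have w01 : 0 < w <= 2 / 3.
      rewrite divr_gt0//=; last lra.
      by rewrite /w ler_pdivrMr; lra.
    apply: (@tradeoff_rare _ _ y _ _ _ w) => //.
      rewrite ler_pdivlMr//; move: G1; rewrite max_l; lra.
    rewrite mulrA ler_pdivlMr//.
    have -> : (1 + t / 3 + w * t) * (q - 1) = (q - 1) + (q + 1) * t / 3.
      by rewrite /w; field; exact: lt0r_neq0.
    by apply: (le_trans G3); apply: ler_wpM2r; [|exact: kq2].
apply: (key c (- (1 - c)) ((1 - (q - 1)) * (c * A + (1 - c)))) => //.
- by rewrite mulr_ge0//; lra.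
- by lra.
- move=> i /cAa /andP[? ?].
  have -> : (q - 2) * (c * a i + - (1 - c)) =
    (1 - (q - 1)) * (- (c * a i) + (1 - c)) by ring.
  by apply: ler_wpM2l; lra.
- apply: (@tradeoff_frequent _ _ y) => //; first lra.
    by move: G1; rewrite max_r ?mul1r//; lra.
  by have := ler_wpM2r G0 (kq1 q2); lra.
Qed.

End Patterns.

(** * One coordinate: both signs against the maximum of the two bounds *)

Section Coordinate.
Context {R : realType}.

(** This is [2 <= p ^ k] for [k = (p + 1) / (3 * (p - 1))], cleared of roots; equality holds at
    [p = 2]. *)
Lemma exp8_le (p : nat) : (1 < p)%N -> (8 ^+ p.-1 : R) <= p%:R ^+ p.+1.
Proof.
move=> p1; have [p8|p8] := leqP 8 p.
  apply: le_trans (_ : p%:R ^+ p.-1 <= _).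
    by rewrite lerXn2r// ?nnegrE// ler_nat.
  by rewrite ler_eXn2l ?ltr1n// (leq_trans (leq_pred p)).
by move: p p1 p8; do 8?[case=> //]; move=> *; lra.
Qed.

(** The excess of the exponent over 1 is [k = (p + 1) / (3 * (p - 1))]. From [p <= expR x], the
    power [3 * (p - 1)] of [2 <= expR (k * x)] reduces to [exp8_le]. *)
Lemma two_expR_le (p : nat) (x : R) : (1 < p)%N -> p%:R * expR (- x) <= 1 ->
  2 * expR (- ((4 / 3 + 2 / (3 * (p%:R - 1))) * x)) <= expR (- x).
Proof.
move=> p1 px1.
have {px1}px : p%:R <= expR x.
  by move: px1; rewrite expRN ler_pdivrMr ?expR_gt0// mul1r.
have p1R : (0 : R) < p%:R - 1 by rewrite subr_gt0 ltr1n.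
pose k : R := 1 / 3 + 2 / (3 * (p%:R - 1)).
have -> : - ((4 / 3 + 2 / (3 * (p%:R - 1))) * x) = - x + - (k * x).
  by rewrite /k; lra.
rewrite expRD mulrCA ger_pMr ?expR_gt0// expRN ler_pdivrMr ?expR_gt0// mul1r.
have n0 : (0 < 3 * p.-1)%N by rewrite muln_gt0/= -ltnS prednK// ltnW.
rewrite -(ler_pXn2r n0) ?nnegrE ?expR_ge0 ?ler0n// -expRM_natl.
have -> : (3 * p.-1)%:R * (k * x) = p.+1%:R * x.
  rewrite natrM -subn1 natrB; last exact: ltnW.
  by rewrite -natr1 /k; field; exact: lt0r_neq0.
rewrite exprM expRM_natl; have -> : (2 : R) ^+ 3 = 8 by ring.
by apply: le_trans (exp8_le p1) _; rewrite lerXn2r ?nnegrE ?expR_ge0 ?ler0n.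
Qed.

(* [expR (- c / F)], with value 0 at [F = 0]. *)
Definition expNdiv (c F : R) : R := if F == 0 then 0 else expR (- c / F).

Lemma coordinate_overshoot (I : finType) (K : {set I}) (a : I -> R)
  (p m : nat) (t A V : R) : K != finset.set0 -> (0 < m <= p)%N -> 0 < t ->
  (forall i, i \in K -> `|a i| <= A) ->
  #|K|%:R^-1 * \sum_(i in K) a i ^+ 2 <= V ->
  let q := p%:R / m%:R in
  let E3 := expNdiv (#|K|%:R * (t ^+ 2 / 2)) (q - 1 + (q + 1) * t / 3) in
  p%:R * E3 <= 1 ->
  2 * (\sum_(f | `[< overshoot K a t f >]) pattern_weight (m%:R / p%:R) f) <
  Num.max (2 * expNdiv (#|K|%:R * (t ^+ 2 / 2))
    ((q - 1) * V + Num.max (q - 1) 1 * A * t / 3)) E3.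
Proof.
move=> K0 /andP[m0 mp] t0 aA aV q E3.
have p0 : (0 < p)%N by exact: leq_trans mp.
have mR : (0 : R) < m%:R by rewrite ltr0n.
have pR : (0 : R) < p%:R by rewrite ltr0n.
have q1 : 1 <= q by rewrite /q ler_pdivlMr// mul1r ler_nat.
have F30 : 0 < q - 1 + (q + 1) * t / 3 by nra.
have qV : m%:R / p%:R = q^-1 :> R by rewrite /q invf_div.
rewrite /E3 {1}/expNdiv gt_eqF//.
set c := #|K|%:R * (t ^+ 2 / 2).
have N0 : (0 : R) < #|K|%:R by rewrite ltr0n card_gt0.
have c0 : 0 < c by rewrite mulr_gt0// divr_gt0// exprn_gt0.
have E30 := expR_gt0 (- c / (q - 1 + (q + 1) * t / 3)).
(* For [m = p], where [q = 1], incomplete patterns have weight 0 and the complete one does not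
   overshoot. *)
move=> pE3; rewrite lt_max; move: mp; rewrite leq_eqVlt => /predU1P[mp|mp].
  apply/orP; right.
  rewrite big1 ?mulr0; first by rewrite /expNdiv gt_eqF.
  move=> f /asboolP [x [sx xy]].
  have [i fi] : exists i, ~~ f i.
    apply/existsP; rewrite -negb_forall; apply/negP => /forallP fT.
    move: sx; under eq_bigl do rewrite fT andbT.
    rewrite sumrB sumr_const -mulr_natl => sx; move: xy.
    have -> : #|K|%:R^-1 * \sum_(i in K) a i = x.
      by apply: (mulfI (lt0r_neq0 N0)); rewrite mulVKf ?lt0r_neq0//; lra.
    by rewrite subrr ltNge mulr_ge0 ?addr_ge0 ?(ltW t0).
  rewrite /pattern_weight (bigD1 i)//= (negbTE fi) -mp divff ?subrr ?mul0r//.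
  exact: lt0r_neq0.
have {}q1 : 1 < q by rewrite /q ltr_pdivlMr// mul1r ltr_nat.
have p1 : (1 < p)%N := leq_ltn_trans m0 mp.
have p1R : (0 : R) < p%:R - 1 by rewrite subr_gt0 ltr1n.
pose kappa : R := 4 / 3 + 2 / (3 * (p%:R - 1)).
have k0 : 0 < kappa by rewrite addr_gt0// divr_gt0// mulr_gt0.
set F1 := (q - 1) * V + _; set F3 := q - 1 + _ in F30 pE3 E30 *.
pose G := Num.max F1 (F3 / kappa).
have H : \sum_(f | `[< overshoot K a t f >]) pattern_weight (m%:R / p%:R) f <
    expR (- c / G).
  rewrite qV; apply: (@overshoot_lt R I K a q t A kappa G K0 q1 t0 aA k0).
  - move=> q2; have qp : q <= p%:R.
      by rewrite /q ler_pdivrMr// ler_peMr ?ler1n// ltW.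
    by rewrite lerD2l ler_wpM2l// lef_pV2 ?posrE; lra.
  (* With [m < p], [p = 2] would force [m = 1] and [q = 2]; so [3 <= p], whence
     [kappa <= 4 / 3 + 1 / 3]. *)
  - move=> q2; have p3 : (2 < p)%N.
      rewrite ltn_neqAle p1 andbT; apply/eqP => p2; move: q2.
      have m1 : m = 1%N by apply/eqP; rewrite eqn_leq m0 andbT -ltnS p2.
      by rewrite /q -p2 m1 divr1 ltxx.
    have : (3 : R) <= p%:R by rewrite ler_nat.
    by move=> p3R; rewrite /kappa -lerBrDl ler_pdivrMr; lra.
  - rewrite /G le_max; apply/orP; left; rewrite lerD2r ler_pM2l//; lra.
  - by rewrite [kappa * G]mulrC -ler_pdivrMr// /G le_max lexx orbT.
have [F13|F13] := leP F1 (F3 / kappa).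
  apply/orP; right; rewrite /expNdiv (gt_eqF F30).
  have := two_expR_le p1 (_ : p%:R * expR (- (c / F3)) <= 1); rewrite -mulNr.
  move=> /(_ pE3); apply: lt_le_trans; rewrite ltr_pM2l//.
  move: H; rewrite /G max_r// -/c; congr (_ < expR _).
  by rewrite -/kappa; field; rewrite !lt0r_neq0.
have F10 : 0 < F1 by apply: le_lt_trans F13; rewrite divr_ge0 ?ltW.
apply/orP; left; rewrite /expNdiv gt_eqF// ltr_pM2l//.
by move: H; rewrite /G max_l// ltW.
Qed.

End Coordinate.

(** * The law of the sampling matrices *)

Section FiniteUnions.
Context d (T : measurableType d) (R : realType) (P : probability T R).

Lemma measure_bigcup_pred (I : finType) (Q : {pred I}) (F : I -> set T) :
  (forall i, measurable (F i)) -> trivIset [set` Q] F ->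
  P (\bigcup_(i in [set` Q]) F i) = (\sum_(i in Q) P (F i))%E.
Proof.
move=> mF tF; rewrite measure_fin_bigcup//.
have -> : [set` Q] = [set` enum Q].
  by apply/seteqP; split => i /=; rewrite mem_enum.
by rewrite -fsbig_seq ?enum_uniq// big_enum.
Qed.

Lemma measure_bigcup_pred_le (I : finType) (Q : {pred I}) (F : I -> set T) :
  (forall i, measurable (F i)) ->
  (P (\bigcup_(i in [set` Q]) F i) <= \sum_(i in Q) P (F i))%E.
Proof.
move=> mF; rewrite bigcup_pred.
suff [] : measurable (\big[setU/set0]_(i in Q) F i) /\
  (P (\big[setU/set0]_(i in Q) F i) <= \sum_(i in Q) P (F i))%E by [].
elim/big_rec2 : _ => [|i y1 y2 _ [my le]].
  by split => //; rewrite measure0.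
split; first exact: measurableU.
by apply: le_trans (measureU2 _ _ _) _ => //; rewrite leeD2l.
Qed.

Lemma measurable_bigcup_pred (I : finType) (Q : {pred I}) (F : I -> set T) :
  (forall i, measurable (F i)) -> measurable (\bigcup_(i in [set` Q]) F i).
Proof. by move=> mF; rewrite bigcup_pred; apply: bigsetU_measurable. Qed.

End FiniteUnions.

Lemma measurable_closed (R : realType) (p m : nat) (C : set 'M[R]_(p, m)) :
  closed C -> measurable (C : set (borel_mx R p m)).
Proof.
move=> cC; rewrite -[C]setCK; apply: measurableC.
by apply: sub_sigma_algebra; exact: closed_openC.
Qed.

Section Sampling.
Context {R : realType} (p m : nat).
Implicit Types (g : 'I_m -> 'I_p) (j : 'I_p).

Lemma sampling_mx_inj (g h : {ffun 'I_m -> 'I_p}) :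
  sampling_mx g = sampling_mx h :> 'M[R]_(p, m) -> g = h.
Proof.
move=> gh; apply/ffunP => l; move/matrixP : gh => /(_ (g l) l).
by rewrite !mxE eqxx; case: eqP => // _ /eqP; rewrite oner_eq0.
Qed.

Lemma sampling_mx_gram g j k : injective g ->
  (sampling_mx g *m (sampling_mx g)^T) j k =
  ((j == k) && (j \in codom g))%:R :> R.
Proof.
move=> injg; rewrite mxE; under eq_bigr do rewrite !mxE -natrM mulnb.
case: (boolP (j \in codom g)) => [/codomP[l ->]|jg].
  rewrite (bigD1 l)//= big1 ?addr0 ?eqxx ?andbT/=; first by rewrite eq_sym.
  by move=> i il; rewrite inj_eq// eq_sym (negbTE il).
rewrite andbF big1// => l _; case: eqP => //= jgl.
by move: jg; rewrite jgl codom_f.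
Qed.

(* The sampling matrices none of whose columns is the j-th basis vector. *)
Definition unsampled j : set (borel_mx R p m) :=
  \bigcup_(g in [set` [pred g : {ffun 'I_m -> 'I_p} |
    injectiveb g && (j \notin codom g)]]) [set sampling_mx g].

Lemma measurable_sampling_mx g :
  measurable [set (sampling_mx g : borel_mx R p m)].
Proof.
apply: measurable_closed; apply: accessible_closed_set1.
by apply: hausdorff_accessible; exact: norm_hausdorff.
Qed.

Lemma measurable_unsampled j : measurable (unsampled j).
Proof.
rewrite /unsampled bigcup_pred; apply: bigsetU_measurable => g _.
exact: measurable_sampling_mx.
Qed.

Lemma unsampledE g j : injective g ->
  unsampled j (sampling_mx g) <-> j \notin codom g.
Proof.
move=> injg; split.
  move=> [h /= /andP[_ jh]] gh.
  apply: contra jh => /codomP[l jgl]; move/matrixP : gh => /(_ j l).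
  rewrite !mxE jgl eqxx; case: eqP => [-> _|_ /eqP]; first exact: codom_f.
  by rewrite oner_eq0.
move=> jg; exists [ffun l => g l].
  apply/andP; split; first by apply/injectiveP => a b; rewrite !ffunE => /injg.
  by apply: contra jg => /codomP[l]; rewrite ffunE => ->; exact: codom_f.
by congr sampling_mx; apply/funext => l; rewrite ffunE.
Qed.

Context d (T : measurableType d) (P : probability T R).
Context (S : {mfun T >-> borel_mx R p m}).
Hypothesis hS : uniform_sampling P S.

Lemma sampling_prob (Q : {pred {ffun 'I_m -> 'I_p}}) :
  (forall g : {ffun 'I_m -> 'I_p}, g \in Q -> injective g) ->
  P (S @^-1` (\bigcup_(g in [set` Q]) [set sampling_mx g])) =
  (#|Q|%:R / (p ^_ m)%:R)%:E.
Proof.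
move=> injQ; rewrite preimage_bigcup measure_bigcup_pred; first last.
- move=> g h _ _ [w []]; rewrite /preimage/= => -> /sampling_mx_inj.
  by [].
- by move=> g; apply: measurable_funPTI; exact: measurable_sampling_mx.
under eq_bigr => g gQ do rewrite (hS (injQ g gQ)).
by rewrite sumEFin sumr_const mulr_natl.
Qed.

Lemma unsampled_prob (j : 'I_p) : (0 < m <= p)%N ->
  P (S @^-1` unsampled j) = (1 - m%:R / p%:R)%:E.
Proof.
move=> /andP[m0 mp]; rewrite sampling_prob; last by move=> g /andP[/injectiveP].
have -> : #|[pred g : {ffun 'I_m -> 'I_p} | injectiveb g && (j \notin codom g)]|
    = (p.-1 ^_ m)%N.
  have := card_inj_ffuns_on 'I_m (predC1 j); rewrite cardC1 !card_ord => <-.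
  apply: eq_card => g; rewrite !inE andbC; congr (_ && _).
  apply/idP/ffun_onP => [jg l|gj].
    by rewrite inE; apply: contra jg => /eqP <-; exact: codom_f.
  by apply/negP => /codomP[l jl]; have := gj l; rewrite inE -jl eqxx.
have p0 : (0 < p)%N := leq_trans m0 mp.
have pR : (p%:R : R) != 0 by rewrite pnatr_eq0 -lt0n.
have fR : ((p ^_ m)%:R : R) != 0 by rewrite pnatr_eq0 -lt0n ffact_gt0.
(* Expanding [p ^_ m.+1] from either end relates the two falling factorials. *)
have := ffactnSr p m; rewrite -{1}(prednK p0) ffactSS prednK// => E.
have {}E : p%:R * (p.-1 ^_ m)%:R = (p ^_ m)%:R * (p%:R - m%:R) :> R.
  by rewrite -natrM E natrM natrB.
congr EFin; apply: (mulfI pR); rewrite mulrA E.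
by field; rewrite pR fR.
Qed.

(** [uniform_sampling] prescribes only the probabilities of the atoms; there are [p ^_ m] of them,
    so they exhaust the mass. *)
Lemma sampling_as : (m <= p)%N ->
  {ae P, forall w, exists g, injective g /\ S w = sampling_mx g}.
Proof.
move=> mp.
pose Q : {pred {ffun 'I_m -> 'I_p}} := [pred g : {ffun _} | injectiveb g].
have mQ : measurable (S @^-1` (\bigcup_(g in [set` Q]) [set sampling_mx g])).
  apply: measurable_funPTI; rewrite bigcup_pred.
  by apply: bigsetU_measurable => g _; exact: measurable_sampling_mx.
exists (~` (S @^-1` (\bigcup_(g in [set` Q]) [set sampling_mx g]))); split.
- exact: measurableC.
- rewrite probability_setC// sampling_prob; last by move=> g /injectiveP.
  have -> : #|Q| = (p ^_ m)%N.
    by have := card_inj_ffuns 'I_m 'I_p; rewrite !card_ord cardsE.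
  by rewrite divff ?subee// pnatr_eq0 -lt0n ffact_gt0.
- move=> w /= nS [g /= /injectiveP injg Sg]; apply: nS.
  by exists g.
Qed.

End Sampling.

Section SampledPatterns.
Context {R : realType} d (T : measurableType d) (P : probability T R).
Context (p m n : nat) (hm : (0 < m <= p)%N).
Context (S : 'I_n -> {mfun T >-> borel_mx R p m}).
Hypothesis hSunif : forall i, uniform_sampling P (S i).
Hypothesis hSindep :
  mutually_independent P (fun i => S i : T -> borel_mx R p m).

Definition pattern_event (j : 'I_p) (f : {ffun 'I_n -> bool}) : set T :=
  \bigcap_(i in [set` [set: 'I_n]%SET])
    S i @^-1` (if f i then ~` unsampled j else unsampled j).

Lemma measurable_pattern_event j f : measurable (pattern_event j f).
Proof.
apply: fin_bigcap_measurable => // i _; apply: measurable_funPTI.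
case: ifP => _; last exact: measurable_unsampled.
exact: measurableC (measurable_unsampled _).
Qed.

(** Distinct coordinates of one sampling matrix are dependent, but for a fixed [j] the inclusion
    indicators are independent over [i], each Bernoulli of parameter [m / p]. *)
Lemma pattern_event_prob j f :
  P (pattern_event j f) = (pattern_weight (m%:R / p%:R) f)%:E.
Proof.
rewrite /pattern_event hSindep; last first.
  move=> i; case: ifP => _; last exact: measurable_unsampled.
  exact: measurableC (measurable_unsampled _).
rewrite /pattern_weight -prodEFin; apply: eq_big => [i|i _].
  by rewrite inE.
case: ifP => _; last by rewrite (unsampled_prob (hSunif i)).
have mU : measurable (S i @^-1` unsampled j).
  by apply: measurable_funPTI; exact: measurable_unsampled.
rewrite preimage_setC probability_setC// (unsampled_prob (hSunif i))//.
by rewrite -EFinB opprB addrCA subrr addr0.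
Qed.

End SampledPatterns.

(** * Reduction to the coordinates *)

Section Norm.
Context {R : realType}.

Lemma l2norm_ge0 (p : nat) (v : 'cV[R]_p) : 0 <= l2norm v.
Proof. exact: sqrtr_ge0. Qed.

Lemma sqr_l2norm (p : nat) (v : 'cV[R]_p) : l2norm v ^+ 2 = \sum_j v j 0 ^+ 2.
Proof. by rewrite sqr_sqrtr// sumr_ge0// => j _; exact: sqr_ge0. Qed.

Lemma orthonormal_mxC (p : nat) (A : 'M[R]_p) :
  orthonormal_mx A -> A *m A^T = 1%:M.
Proof. exact: mulmx1C. Qed.

Lemma l2norm_orthonormal (p : nat) (A : 'M[R]_p) (v : 'cV[R]_p) :
  orthonormal_mx A -> l2norm (A^T *m v) = l2norm v.
Proof.
have dot (w : 'cV[R]_p) : \sum_j w j 0 ^+ 2 = (w^T *m w) 0 0.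
  by rewrite mxE; apply: eq_bigr => j _; rewrite mxE expr2.
move=> /orthonormal_mxC AA; rewrite /l2norm !dot trmx_mul trmxK mulmxA.
by rewrite -(mulmxA v^T) AA mulmx1.
Qed.

Lemma orthonormal_mul_sign (p : nat) (A : 'M[R]_p) (e : 'rV[R]_p) :
  orthonormal_mx A -> (forall j, e 0 j = 1 \/ e 0 j = -1) ->
  orthonormal_mx (A *m diag_mx e).
Proof.
move=> AA e1; rewrite /orthonormal_mx trmx_mul mulmxA -(mulmxA _ A^T) AA mulmx1.
rewrite tr_diag_mx mulmx_diag; apply/matrixP => j k; rewrite !mxE.
by case: (e1 j) => ->; rewrite ?mulrNN mulr1.
Qed.

Lemma l2norm_entrywise (p : nat) (x z : 'cV[R]_p) (t : R) :
  (0 < p)%N -> 0 <= t ->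
  (forall j, `|x j 0 - z j 0| <= t * (1 + `|x j 0|)) ->
  l2norm (x - z) <= t * (Num.sqrt p%:R + l2norm x).
Proof.
move=> p0 t0 H; have pR : (0 : R) < p%:R by rewrite ltr0n.
set r := Num.sqrt p%:R; have r0 : 0 <= r by exact: sqrtr_ge0.
have rr : r ^+ 2 = p%:R by rewrite sqr_sqrtr// ltW.
have B0 : 0 <= t * (r + l2norm x) by rewrite mulr_ge0// addr_ge0// l2norm_ge0.
rewrite -(ler_pXn2r (n := 2))// ?nnegrE ?l2norm_ge0// sqr_l2norm exprMn.
pose s := \sum_j `|x j 0|.
have s0 : 0 <= s by apply: sumr_ge0.
(* Cauchy-Schwarz, from the nonnegative variance of the [|x j 0|]. *)
have : s ^+ 2 <= (r * l2norm x) ^+ 2.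
  have : 0 <= \sum_j (`|x j 0| - s / p%:R) ^+ 2.
    by apply: sumr_ge0 => j _; exact: sqr_ge0.
  have -> : \sum_j (`|x j 0| - s / p%:R) ^+ 2 =
      \sum_j (x j 0 ^+ 2 + (- (2 * s / p%:R) * `|x j 0| + (s / p%:R) ^+ 2)).
    by apply: eq_bigr => j _; rewrite -[x j 0 ^+ 2]real_normK ?num_real//; ring.
  rewrite !big_split/= -mulr_sumr -/s sumr_const card_ord -mulr_natl.
  rewrite [(r * _) ^+ 2]exprMn rr sqr_l2norm => h.
  rewrite -subr_ge0; move: (mulr_ge0 (ltW pR) h); congr (_ <= _).
  by field; exact: lt0r_neq0.
rewrite ler_pXn2r ?nnegrE ?mulr_ge0 ?l2norm_ge0// => srx.
apply: le_trans (_ : \sum_j t ^+ 2 * (1 + (2 * `|x j 0| + x j 0 ^+ 2)) <= _).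
  apply: ler_sum => j _; rewrite !mxE -real_normK ?num_real//.
  apply: le_trans (_ : (t * (1 + `|x j 0|)) ^+ 2 <= _).
    by rewrite ler_pXn2r ?nnegrE ?mulr_ge0 ?addr_ge0.
  rewrite exprMn -[x j 0 ^+ 2]real_normK ?num_real// le_eqVlt.
  by apply/orP; left; apply/eqP; ring.
rewrite -mulr_sumr ler_wpM2l ?sqr_ge0// !big_split/= -mulr_sumr sumr_const.
by rewrite card_ord -/s -sqr_l2norm sqrrD rr; lra.
Qed.

Lemma continuous_l2norm_affine (p k : nat) (A : 'M[R]_(k, p)) (b : 'cV[R]_k) :
  continuous (fun v : 'cV[R]_p => l2norm (A *m v - b)).
Proof.
move=> v; apply: (@continuous_comp _ _ _ (fun v : 'cV[R]_p =>
  \sum_j (A *m v - b) j 0 ^+ 2) (@Num.sqrt R)); last exact: sqrt_continuous.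
apply: (continuous_big (op := +%R)) => [|j _]; first exact: add_continuous.
rewrite (_ : (fun u : 'cV[R]_p => _) =
  (fun u : 'cV[R]_p => (\sum_l A j l * u l 0 - b j 0) ^+ 2)); last first.
  by apply/funext => u; rewrite !mxE.
have sqC : continuous (fun x : R => (x - b j 0) ^+ 2).
  move=> x; apply: (@continuous_comp _ _ _ (fun x : R => x - b j 0)
    (fun x : R => x ^+ 2)); last exact: exprn_continuous.
  by apply: cvgB; [exact: cvg_id|exact: cvg_cst].
move=> u; apply: (@continuous_comp _ _ _ (fun u : 'cV[R]_p =>
  \sum_l A j l * u l 0) (fun x : R => (x - b j 0) ^+ 2)); last exact: sqC.
apply: (continuous_big (op := +%R)) => [|l _]; first exact: add_continuous.
move=> z; apply: (@continuous_comp _ _ _ (fun u : 'cV[R]_p => u l 0)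
  (fun x : R => A j l * x)); first exact: coord_continuous.
exact: mulrl_continuous.
Qed.

(** Used to see the success event as the preimage of a closed set, hence measurable. *)
Lemma closed_le_affine (V : topologicalType) (u w : V -> R) (r t : R) :
  continuous u -> continuous w -> closed [set v | r * u v <= t * (1 + r * w v)].
Proof.
move=> cu cw; pose F v := t * (1 + r * w v) - r * u v.
rewrite (_ : [set v | _] = F @^-1` [set x | 0 <= x]); last first.
  by apply/seteqP; split => v /=; rewrite /F subr_ge0.
apply: preimage_closed; last exact: closed_ge.
move=> v _; apply: cvgB; apply: cvgMl_tmp; last exact: cu.
by apply: cvgD; [exact: cvg_cst|apply: cvgMl_tmp; exact: cw].
Qed.

End Norm.

Section Rows.
Context {R : realType}.

(** Each [S i *m (S i)^T] is a diagonal 0-1 projector, so the linear system decouples into rows. *)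
Lemma sampled_row_eq (p m n : nat) (Ik : {set 'I_n}) (S : 'I_n -> 'M[R]_(p, m))
  (Y : 'M[R]_(p, n)) (x : 'cV[R]_p) (g : 'I_n -> 'I_m -> 'I_p) (j : 'I_p) :
  (0 < m <= p)%N -> Ik != finset.set0 ->
  (forall i, injective (g i)) -> (forall i, S i = sampling_mx (g i)) ->
  sampled_gram Ik S *m x = sampled_mean Ik S Y ->
  \sum_(i in Ik | j \in codom (g i)) (x j 0 - Y j i) = 0.
Proof.
move=> /andP[m0 mp] K0 injg Sg /matrixP /(_ j 0).
have c0 : (p%:R / m%:R / #|Ik|%:R : R) != 0.
  rewrite !mulf_neq0 ?invr_eq0 ?pnatr_eq0 -?lt0n ?card_gt0//.
  exact: leq_trans mp.
have row i (z : 'cV[R]_p) :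
    (S i *m (S i)^T *m z) j 0 = (j \in codom (g i))%:R * z j 0.
  rewrite mxE (bigD1 j)//= big1 ?addr0 => [|k kj].
    by rewrite Sg sampling_mx_gram// eqxx.
  by rewrite Sg sampling_mx_gram// eq_sym (negbTE kj) mul0r.
rewrite /sampled_gram /sampled_mean -scalemxAl [LHS]mxE [RHS]mxE => /(mulfI c0).
rewrite mulmx_suml !summxE => /eqP; rewrite -subr_eq0 -sumrB => /eqP E.
rewrite -[RHS]E big_mkcondr; apply: eq_bigr => i _; rewrite !row mxE.
by case: ifP => _; rewrite ?mul1r// !mul0r subrr.
Qed.

Lemma maxrow_norm_ge (p n : nat) (Y : 'M[R]_(p, n)) (K : {set 'I_n}) j :
  \sum_(i in K) Y j i ^+ 2 <= maxrow_norm Y ^+ 2.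
Proof.
apply: le_trans (_ : l2norm (row j Y)^T ^+ 2 <= _).
  rewrite sqr_l2norm [leLHS]big_mkcond; apply: ler_sum => i _; rewrite !mxE.
  by case: ifP => // _; exact: sqr_ge0.
have h : l2norm (row j Y)^T <= maxrow_norm Y by exact: le_bigmax.
by rewrite ler_pXn2r ?nnegrE ?l2norm_ge0//; exact: le_trans (l2norm_ge0 _) h.
Qed.

Lemma ler_entry_norm (p n : nat) (Y : 'M[R]_(p, n)) j i : `|Y j i| <= `|Y|.
Proof.
rewrite -[`|Y|]/(mx_norm Y) mx_normrE.
exact: (@le_bigmax _ _ _ _ (fun ij => `|Y ij.1 ij.2|) (j, i)).
Qed.

End Rows.

(** At [F = 0] the extended quotient is [-oo], as [c] is positive, and its exponential is 0. *)
Lemma expeR_expNdiv (R : realType) (c F : R) : 0 < c ->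
  expeR ((- c)%:E / F%:E) = (expNdiv c F)%:E.
Proof.
move=> c0; rewrite /expNdiv inver; case: ifP => _ //=.
by rewrite mulry ltr0_sg ?oppr_lt0// mulN1e.
Qed.

(** * Union bound over rows and signs, and return to the original coordinates *)

Theorem theorem8 (R : realType) (d : measure_display) (T : measurableType d)
  (P : probability T R) (p m n : nat) (hm : (1 <= m)%N) (hmp : (m <= p)%N)
  (X : 'M[R]_(p, n))
  (H : 'M[R]_p) (hH : orthonormal_mx H)
  (e : 'rV[R]_p) (he : forall j, e 0 j = 1 \/ e 0 j = -1)
  (S : 'I_n -> {mfun T >-> borel_mx R p m})
  (hSunif : forall i, uniform_sampling P (S i))
  (hSindep : mutually_independent P (fun i => S i : T -> borel_mx R p m))
  (Ik : {set 'I_n}) (hIk : Ik != finset.set0)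
  (mu' : {mfun T >-> borel_mx R p 1})
  (hmu' : {ae P, forall w,
     sampled_gram Ik (fun i => S i w) *m mu' w =
     sampled_mean Ik (fun i => S i w) (H *m diag_mx e *m X)}) :
  let HD := H *m diag_mx e in
  let Y := HD *m X in
  let nk := #|Ik| in
  let mu := fun w => HD^T *m (mu' w : 'cV[R]_p) in
  let xbar := nk%:R^-1 *: \sum_(i in Ik) col i X in
  forall t : R, 0 <= t ->
  (1 - maxe (delta1 m nk Y t) (delta3 p m nk t)
   < P [set w | (Num.sqrt p%:R)^-1 * l2norm (mu w - xbar)
                <= t * (1 + (Num.sqrt p%:R)^-1 * l2norm (mu w))]%R)%E.
Proof.
move=> HD Y nk mu xbar t t0.
have p0 : (0 < p)%N := leq_trans hm hmp.
have mp : (0 < m <= p)%N by rewrite hm.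
set Good := [set w | _].
have vacuous : (1 < maxe (delta1 m nk Y t) (delta3 p m nk t) ->
    1 - maxe (delta1 m nk Y t) (delta3 p m nk t) < P Good)%E.
  by move=> D1; apply: lt_le_trans (measure_ge0 P Good); rewrite sube_lt0.
(* At [t = 0] the exponent of [delta1] is 0, so [delta1 = 2 * p > 1]. *)
move: t0; rewrite le_eqVlt => /predU1P[t0|t0].
  apply: vacuous; rewrite lt_max; apply/orP; left.
  rewrite /delta1 -t0 expr0n/= mul0r mulr0 oppr0 mul0e expeR0 mule1 lte_fin.
  by rewrite ltr1n -[1%N]/(2 * 1).-1 prednK// leq_mul2l.
have N0 : (0 : R) < nk%:R by rewrite ltr0n card_gt0.
pose q : R := p%:R / m%:R.
pose c : R := nk%:R * (t ^+ 2 / 2).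
pose E1 : R := expNdiv c ((q - 1) * (maxrow_norm Y ^+ 2 / nk%:R) +
  Num.max (q - 1) 1 * `|Y| * t / 3).
pose E3 : R := expNdiv c (q - 1 + (q + 1) * t / 3).
have c0 : 0 < c by rewrite mulr_gt0// divr_gt0// exprn_gt0.
have d1E : delta1 m nk Y t = (p%:R * (2 * E1))%:E.
  rewrite /delta1 expeR_expNdiv// -EFinM natrM mulrAC mulrC.
  by rewrite /E1 (mulrA (q - 1)).
have d3E : delta3 p m nk t = (p%:R * E3)%:E by rewrite /delta3 expeR_expNdiv.
rewrite d1E d3E -EFin_max -maxr_pMr// in vacuous *.
have [pM|pM] := ltP 1 (p%:R * Num.max (2 * E1) E3); first exact: vacuous.
have {vacuous} pE3 : p%:R * E3 <= 1.
  by apply: le_trans pM; rewrite ler_wpM2l// le_max lexx orbT.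
have orthHD : orthonormal_mx HD := orthonormal_mul_sign hH he.
pose ybar := nk%:R^-1 *: \sum_(i in Ik) col i Y.
have xbarE : xbar = HD^T *m ybar.
  rewrite /ybar -scalemxAr mulmx_sumr; congr (_ *: _); apply: eq_bigr => i _.
  by rewrite /Y !colE -[HD *m X *m _]mulmxA (mulmxA HD^T HD) orthHD mul1mx.
(* A violation from below is an overshoot of the negated row; the factors [1] and [-1] let both
   signs share one bound. *)
pose bad := [pred jf : 'I_p * {ffun 'I_n -> bool} |
  `[< overshoot Ik (fun i => 1 * Y jf.1 i) t jf.2 >] ||
  `[< overshoot Ik (fun i => -1 * Y jf.1 i) t jf.2 >]].
pose Bad := \bigcup_(jf in [set` bad]) pattern_event S jf.1 jf.2.
have mBad : measurable Bad.
  by apply: measurable_bigcup_pred => jf; exact: measurable_pattern_event.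
have PBad : (P Bad < (p%:R * Num.max (2 * E1) E3)%:E)%E.
  apply: le_lt_trans (measure_bigcup_pred_le P _ _) _.
    by move=> jf; exact: measurable_pattern_event.
  under eq_bigr do rewrite (pattern_event_prob mp hSunif hSindep).
  rewrite sumEFin lte_fin.
  pose W := @pattern_weight R 'I_n (m%:R / p%:R).
  have W0 f : 0 <= W f.
    apply: prodr_ge0 => i _; case: ifP => _; first by rewrite divr_ge0.
    by rewrite subr_ge0 ler_pdivrMr ?mul1r ?ler_nat ?ltr0n.
  pose over (sgn : R) j :=
    \sum_(f | `[< overshoot Ik (fun i => sgn * Y j i) t f >]) W f.
  have over_lt sgn j : (sgn == 1) || (sgn == -1) ->
      2 * over sgn j < Num.max (2 * E1) E3.
    move=> sgn1; have sgnY i : `|sgn * Y j i| = `|Y j i|.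
      by case/orP: sgn1 => /eqP ->; rewrite ?mul1r// mulN1r normrN.
    apply: coordinate_overshoot => //.
      by move=> i _; rewrite sgnY; exact: ler_entry_norm.
    rewrite mulrC ler_pM2r ?invr_gt0//.
    under eq_bigr do
      rewrite -real_normK ?num_real// sgnY real_normK ?num_real//.
    exact: maxrow_norm_ge.
  apply: le_lt_trans (_ : \sum_j (over 1 j + over (-1) j) < _).
    have -> : \sum_(jf in bad) W jf.2 = \sum_j \sum_(f | bad (j, f)) W f.
      by rewrite pair_big_dep/=; apply: eq_bigl => -[].
    apply: ler_sum => j _; rewrite /over !(big_mkcond (fun f => asbool _)).
    rewrite [leLHS]big_mkcond -big_split/=; apply: ler_sum => f _.
    have := W0 f; case: asboolP => _; case: asboolP => _ /=; lra.
  rewrite mulr_natl -[X in _ *+ X]card_ord -sumr_const.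
  (* Strictness in every row survives summation because [0 < p] makes the index range nonempty. *)
  apply: ltr_sum.
    by apply/hasP; exists (Ordinal p0); rewrite ?mem_index_enum.
  move=> j _.
  have := over_lt 1 j; have := over_lt (-1) j.
  rewrite !eqxx ?orbT => /(_ isT) o1 /(_ isT) o2.
  lra.
have mGood : measurable Good.
  rewrite -[Good]/(mu' @^-1` [set v : 'cV[R]_p |
    (Num.sqrt p%:R)^-1 * l2norm (HD^T *m v - xbar) <=
    t * (1 + (Num.sqrt p%:R)^-1 * l2norm (HD^T *m v))]).
  apply: measurable_funPTI; apply: measurable_closed; apply: closed_le_affine.
    exact: continuous_l2norm_affine.
  rewrite (_ : (fun v : 'cV[R]_p => _) =
    (fun v : 'cV[R]_p => l2norm (HD^T *m v - 0))).
    exact: continuous_l2norm_affine.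
  by apply/funext => v; rewrite subr0.
have : {ae P, forall w,
   (forall i, exists g, injective g /\ S i w = sampling_mx g) /\
   sampled_gram Ik (fun i => S i w) *m mu' w =
   sampled_mean Ik (fun i => S i w) Y}.
  have aeF := ae_filter_ringOfSetsType P.
  have samp := filter_forall aeF (fun i => sampling_as (hSunif i) hmp).
  by apply: (filterS2 aeF _ samp hmu') => w.
move=> [N [mN PN0 subN]].
have GoodBad : ~` Good `<=` Bad `|` N.
  move=> w nGood; have [|nNw] := pselect (N w); first by right.
  left; apply: contrapT => nBad; apply: nGood.
  have [/choice[g Sg] eqw] :
      (forall i, exists g, injective g /\ S i w = sampling_mx g) /\
      sampled_gram Ik (fun i => S i w) *m mu' w =
      sampled_mean Ik (fun i => S i w) Y.
    by apply: contrapT => /subN.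
  have row j := sampled_row_eq j mp hIk (fun i => (Sg i).1)
    (fun i => (Sg i).2) eqw.
  pose x : 'cV[R]_p := mu' w.
  have ybarE j : ybar j 0 = nk%:R^-1 * \sum_(i in Ik) Y j i.
    by rewrite mxE summxE; congr (_ * _); apply: eq_bigr => i _; rewrite mxE.
  have entry j : `|x j 0 - ybar j 0| <= t * (1 + `|x j 0|).
    pose f := [ffun i => j \in codom (g i)].
    have Ef : pattern_event S j f w.
      move=> i _; rewrite /preimage/= (Sg i).2 ffunE; case: ifP => jg.
        by move=> /(unsampledE _ (Sg i).1); rewrite jg.
      by apply/(unsampledE _ (Sg i).1); rewrite jg.
    have /norP[/asboolPn no1 /asboolPn no2] : ~~ bad (j, f).
      by apply/negP => bjf; apply: nBad; exists (j, f).
    have rowf : \sum_(i in Ik | f i) (x j 0 - Y j i) = 0.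
      by under eq_bigl do rewrite ffunE.
    rewrite ler_norml lerNl opprB.
    apply/andP; split; rewrite leNgt; apply/negP => h.
      (* The entry lies too far below its mean, so [- x j 0] overshoots for the negated row. *)
      apply: no2; exists (- x j 0); split.
        transitivity (- \sum_(i in Ik | f i) (x j 0 - Y j i)).
          by rewrite -sumrN; apply: eq_bigr => i _; ring.
        by rewrite rowf oppr0.
      rewrite -mulr_sumr normrN mulN1r mulrN opprK [- x j 0 + _]addrC.
      by move: h; rewrite ybarE.
    apply: no1; exists (x j 0); split.
      by rewrite -[RHS]rowf; apply: eq_bigr => i _; rewrite mul1r.
    by rewrite -mulr_sumr mul1r; move: h; rewrite ybarE.
  have := l2norm_entrywise p0 (ltW t0) entry.
  rewrite /Good /= /mu xbarE -/x -mulmxBr !l2norm_orthonormal// => le.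
  have sp : 0 < Num.sqrt p%:R :> R by rewrite sqrtr_gt0 ltr0n.
  rewrite mulrC ler_pdivrMr//; apply: le_trans le _.
  rewrite le_eqVlt; apply/orP; left.
  by apply/eqP; field; exact: lt0r_neq0.
have PG : (P (~` Good) < (p%:R * Num.max (2 * E1) E3)%:E)%E.
  apply: le_lt_trans PBad; apply: le_trans (_ : P (Bad `|` N) <= _)%E.
    apply: le_measure; rewrite ?inE//; first exact: measurableC.
    exact: measurableU.
  by rewrite measureU0.
rewrite -[Good]setCK probability_setC; last exact: measurableC.
have fG : P (~` Good) \is a fin_num.
  by apply: fin_num_measure; exact: measurableC.
by move: PG; rewrite -(fineK fG) lte_fin => PG; rewrite -!EFinB lte_fin; lra.
Qed.
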